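(* Let $d\geq 1$ and let $f:\mathbb{R}_+^d\to\mathbb{R}$ be a Lebesgue measurable componentwise subadditive function. Then $f$ is bounded (from above and from below) in every compact subset of $\mathbb{R}_+^d$.
   Context: $\mathbb{R}_+$ is the set of positive real numbers (zero excluded), an additive semigroup. A function $g$ on an additive semigroup $S$ is subadditive if $g(x+y)\leq g(x)+g(y)$ for all $x,y\in S$. A function $f$ on a product $S_1\times\cdots\times S_d$ of semigroups is componentwise subadditive if, for every $i\in\{1,\ldots,d\}$ and every fixed choice of $x_j\in S_j$ for all $j\neq i$, the function $x_i\mapsto f(x_1,\ldots,x_i,\ldots,x_d)$ is subadditive on $S_i$. *)

(* Defs.v *)
From mathcomp Require Import all_boot all_order all_algebra.
From mathcomp Require Import all_classical all_reals all_analysis.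

Set Implicit Arguments.
Unset Strict Implicit.
Unset Printing Implicit Defensive.

Import Order.TTheory GRing.Theory Num.Theory numFieldNormedType.Exports.

Local Open Scope classical_set_scope.
Local Open Scope ring_scope.

(* MathComp-Analysis equips ['rV[R]_d] with its topology but has no Lebesgue
   sigma-algebra on it. As usual, it is the Caratheodory sigma-algebra of the
   Lebesgue outer measure, obtained from countable covers by closed boxes. *)

Definition closed_box (R : realType) (d : nat) (ab : 'rV[R]_d * 'rV[R]_d) :
    set 'rV[R]_d :=
  [set x | forall i : 'I_d, ab.1 ord0 i <= x ord0 i <= ab.2 ord0 i].

(* The volume of [closed_box ab], provided [ab.1 <= ab.2] coordinatewise. *)
Definition box_volume (R : realType) (d : nat) (ab : 'rV[R]_d * 'rV[R]_d) : R :=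
  \prod_(i < d) (ab.2 ord0 i - ab.1 ord0 i).

Definition box_cover (R : realType) (d : nat) (A : set 'rV[R]_d) :
    set (nat -> 'rV[R]_d * 'rV[R]_d) :=
  [set ab : nat -> 'rV[R]_d * 'rV[R]_d |
            (forall k (i : 'I_d), (ab k).1 ord0 i <= (ab k).2 ord0 i) /\
            A `<=` \bigcup_k closed_box (ab k)].

(* For [d = 0] every box has volume 1, so this is an outer measure only for
   [0 < d]. *)
Definition lebesgue_outer_measure (R : realType) (d : nat) (A : set 'rV[R]_d) :
    \bar R :=
  ereal_inf [set (\sum_(0 <= k <oo) (box_volume (ab k))%:E)%E
            | ab in box_cover A].

Definition lebesgue_measurable (R : realType) (d : nat) (A : set 'rV[R]_d) :
    Prop :=
  caratheodory_measurable (@lebesgue_outer_measure R d) A.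

(* Functions on a domain [D] of R^d are total functions whose values outside
   [D] are irrelevant. *)
Definition lebesgue_measurable_fun (R : realType) (d : nat) (D : set 'rV[R]_d)
    (f : 'rV[R]_d -> R) : Prop :=
  forall B : set R, measurable B -> lebesgue_measurable (D `&` f @^-1` B).

Definition pos_reals (R : realType) : set R := [set x | 0 < x].
Arguments pos_reals : clear implicits.

Definition pos_orthant (R : realType) (d : nat) : set 'rV[R]_d :=
  [set x | forall i : 'I_d, pos_reals R (x ord0 i)].
Arguments pos_orthant : clear implicits.

Definition subadditive_on (R : realType) (S : set R) (g : R -> R) : Prop :=
  forall x y, S x -> S y -> g (x + y) <= g x + g y.

Definition set_coord (R : realType) (d : nat) (x : 'rV[R]_d) (i : 'I_d) (s : R) :
    'rV[R]_d :=
  \row_j (if j == i then s else x ord0 j).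

(* Only the coordinates of [x] other than the [i]-th matter. *)
Definition componentwise_subadditive (R : realType) (d : nat)
    (f : 'rV[R]_d -> R) : Prop :=
  forall (i : 'I_d) (x : 'rV[R]_d),
    (forall j, j != i -> pos_reals R (x ord0 j)) ->
    subadditive_on (pos_reals R) (fun s => f (set_coord x i s)).

(* Main.v *)
Require Import Defs.
From mathcomp Require Import all_boot all_order all_algebra.
From mathcomp Require Import all_classical all_reals all_analysis.
From HB Require Import structures.
From mathcomp Require Import measurable_realfun lra.
Set Implicit Arguments.
Unset Strict Implicit.
Unset Printing Implicit Defensive.
Import Order.TTheory GRing.Theory Num.Theory numFieldNormedType.Exports.
Local Open Scope classical_set_scope.
Local Open Scope ring_scope.

(** Let [x] lie in a cube [[a, b]^d] with [0 < a], and let [0 < y < x]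
    coordinatewise. Splitting each coordinate [x_i] as [y_i + (x_i - y_i)]
    bounds [f x] by a sum of [2 ^ d] values of [f] at points obtained from [y]
    by replacing some coordinates [y_i] with [x_i - y_i]. One of these values
    is therefore at least [f x / 2 ^ d] ([exists_reflection_ge]).

    Upper bound ([bounded_above_on_cube]). Suppose [f x > 2 ^ d * n] and let
    [E n] be the set where [f >= n]. Every [y] of the cube [[a/3, 2a/3]^d] is
    sent into the part of [E n] inside [[0, b]^d] by one of the [2 ^ d]
    reflections attached to [x]. Reflections do not change Lebesgue outer
    measure, so this part of [E n] has measure at least
    [(a/3) ^ d / 2 ^ d], a bound that depends neither on [x] nor on [n]. But
    these parts decrease to the empty set inside a set of finite measure, so
    for large [n] such an [x] cannot exist. This is where measurability of [f]
    enters.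

    Lower bound. Take [c > b] and exchange the coordinates of [(c, ..., c)] for
    those of [x] one at a time: [c = x_i + (c - x_i)], and each exchange costs
    one value of [f] at a point whose coordinates are all of the form [x_i],
    [c] or [c - x_i]. These points stay in a fixed cube of the open orthant,
    where [f] is bounded above by some [M]; hence
    [f (c, ..., c) <= f x + d * M] ([le_swap_coords]).

    The measure theory behind the upper bound is that covers by boxes define
    an outer measure, which makes the Caratheodory theory available, and that
    a cube has positive outer measure ([lebesgue_outer_measure_cube_ge]). *)

(** * Lebesgue outer measure as an outer measure *)

Lemma box_volume_ge0 (R : realType) (d : nat) (ab : 'rV[R]_d * 'rV[R]_d) :
  (forall i, ab.1 ord0 i <= ab.2 ord0 i) -> 0 <= box_volume ab.
Proof. by move=> le_ab; apply: prodr_ge0 => i _; rewrite subr_ge0. Qed.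

Lemma lebesgue_outer_measure_ge0 (R : realType) (d : nat) (A : set 'rV[R]_d) :
  (0 <= lebesgue_outer_measure A)%E.
Proof.
apply: le_ereal_inf_tmp => _ [ab [le_ab _] <-].
by apply: nneseries_ge0 => k _ _; rewrite lee_fin box_volume_ge0.
Qed.

Lemma le_lebesgue_outer_measure (R : realType) (d : nat) (A B : set 'rV[R]_d) :
  A `<=` B -> (lebesgue_outer_measure A <= lebesgue_outer_measure B)%E.
Proof.
move=> AB; apply: ereal_inf_le_tmp => _ [ab [le_ab cB] <-].
by exists ab => //; split=> //; exact: subset_trans cB.
Qed.

(** One box is made into an infinite cover by adding degenerate boxes; these
    have volume zero because the dimension is positive. *)
Lemma lebesgue_outer_measure_box_le (R : realType) (d : nat)
    (ab : 'rV[R]_d.+1 * 'rV[R]_d.+1) (A : set 'rV[R]_d.+1) :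
  (forall i, ab.1 ord0 i <= ab.2 ord0 i) -> A `<=` closed_box ab ->
  (lebesgue_outer_measure A <= (box_volume ab)%:E)%E.
Proof.
move=> le_ab sA; pose cov (k : nat) : 'rV[R]_d.+1 * 'rV[R]_d.+1 := if k is 0%N then ab else (0, 0).
apply: ge_ereal_inf; exists (box_volume ab)%:E => //.
exists cov; first split.
- by case=> [|k] i //=.
- by move=> x /sA ?; exists 0%N.
rewrite nneseries_recl //; last first.
  move=> [|k] _ ; rewrite lee_fin box_volume_ge0//=.
rewrite eseries_cond /= eseries0 ?adde0 // => -[|k] //= _ _.
by rewrite /box_volume big_ord_recl /= mxE subrr mul0r.
Qed.

Lemma lebesgue_outer_measure0 (R : realType) (d : nat) :
  lebesgue_outer_measure (set0 : set 'rV[R]_d.+1) = 0%E.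
Proof.
apply/eqP; rewrite eq_le lebesgue_outer_measure_ge0 andbT.
have := @lebesgue_outer_measure_box_le R d (0, 0) set0.
rewrite /box_volume big_ord_recl /= mxE subrr mul0r; apply => //.
Qed.

(** Near-optimal covers of the [A n], with errors [e / 2 ^ n.+1] adding up to
    [e], are merged into a single cover along a bijection between [nat] and
    [nat * nat]; sums of nonnegative terms can be reordered freely. *)
Lemma lebesgue_outer_measure_sigma_subadditive (R : realType) (d : nat) :
  sigma_subadditive (@lebesgue_outer_measure R d).
Proof.
move=> A; have [[i Ai]|] := pselect (exists i, lebesgue_outer_measure (A i) = +oo%E).
  rewrite (eseries_pinfty _ _ Ai) ?leey// => n _.
  by rewrite -ltNye (lt_le_trans _ (lebesgue_outer_measure_ge0 _)).
rewrite -forallNE => Afin.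
apply/lee_addgt0Pr => e e0.
rewrite (le_trans _ (epsilon_trick _ _ (ltW e0)))//; last first.
  by move=> n; exact: lebesgue_outer_measure_ge0.
have [G PG] : {G : nat -> nat -> 'rV[R]_d * 'rV[R]_d & forall n,
    box_cover (A n) (G n) /\
    (\sum_(k <oo) (box_volume (G n k))%:E <=
      lebesgue_outer_measure (A n) + (e / (2 ^ n.+1)%:R)%:E)%E}.
  apply: (@choice _ _ (fun n g => box_cover (A n) g /\
    (\sum_(k <oo) (box_volume (g k))%:E <=
      lebesgue_outer_measure (A n) + (e / (2 ^ n.+1)%:R)%:E)%E)) => n.
  have en : 0 < e / (2 ^ n.+1)%:R by rewrite divr_gt0// ltr0n expn_gt0.
  have : lebesgue_outer_measure (A n) \is a fin_num.
    rewrite ge0_fin_numE ?lebesgue_outer_measure_ge0// ltey.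
    exact/eqP/Afin.
  by move=> /(lb_ereal_inf_adherent en)[_ [g cg <-]] /ltW; exists g.
pose v (p : nat * nat) : \bar R := (box_volume (G p.1 p.2))%:E.
have v0 p : (0 <= v p)%E.
  by rewrite lee_fin box_volume_ge0 => // i; exact: (PG p.1).1.1.
have bound n : (\sum_(k <oo) v (n, k) <=
    lebesgue_outer_measure (A n) + (e / (2 ^ n.+1)%:R)%:E)%E := (PG n).2.
apply: (@le_trans _ _ (\sum_(n <oo) \sum_(k <oo) v (n, k))%E); last first.
  by apply: lee_nneseries => // n _ _; exact: nneseries_ge0.
have -> : (\sum_(n <oo) \sum_(k <oo) v (n, k) = \esum_(p in [set: nat * nat]) v p)%E.
  rewrite nneseries_esumT; last by move=> n; exact: nneseries_ge0.
  transitivity (\esum_(n in [set: nat]) \esum_(k in [set: nat]) v (n, k))%E.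
    by apply: eq_esum => n _; rewrite nneseries_esumT.
  rewrite (esum_esum (a := fun n k => v (n, k))) //.
  have -> : [set: nat] `*`` (fun=> [set: nat]) = [set: nat * nat].
    by apply/seteqP; split.
  by apply: eq_esum => -[].
have /card_esym/ppcard_eqP[h] := card_nat2.
rewrite (@reindex_esum _ _ _ [set: nat] _ h) //.
rewrite -nneseries_esumT; last by move=> n; exact: v0.
apply: ge_ereal_inf; exists (\sum_(n <oo) v (h n))%E => //.
exists (fun n => G (h n).1 (h n).2) => //; split.
  by move=> k i; exact: (PG _).1.1.
move=> t [n _ /(PG n).1.2[k _ Gt]].
exists (h^-1%FUN (n, k)) => //=.
by rewrite invK ?inE.
Qed.

HB.instance Definition _ (R : realType) (d : nat) :=
  isOuterMeasure.Build R 'rV[R]_d.+1 (@lebesgue_outer_measure R d.+1)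
    (lebesgue_outer_measure0 R d) (@lebesgue_outer_measure_ge0 R d.+1)
    (@le_lebesgue_outer_measure R d.+1)
    (@lebesgue_outer_measure_sigma_subadditive R d.+1).

(** * Cubes have positive outer measure *)

(** In terms of indicators, a cover of a cube by boxes is a pointwise inequality
    between [1] and a sum of products of one-variable indicators. Integrating
    over one coordinate at a time turns each indicator into at most the length
    of its interval, and hence the sum into the total volume. The weights [c]
    absorb the lengths of the coordinates already integrated, which lets the
    induction on the dimension go through. *)
Lemma le_coef_sum_prod_indic (R : realType) (p q : R) (l u : nat -> nat -> R) :
  p <= q -> (forall k i, l k i <= u k i) ->
  forall d (c : nat -> R) (C : R), (forall k, 0 <= c k) -> 0 <= C ->
  (forall x : nat -> R, (forall i, p <= x i <= q) ->
    (C%:E <= \sum_(k <oo)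
      (c k * \prod_(i < d) \1_`[l k i, u k i]%classic (x i))%:E)%E) ->
  ((C * (q - p) ^+ d)%:E <=
    \sum_(k <oo) (c k * \prod_(i < d) (u k i - l k i))%:E)%E.
Proof.
move=> pq lu; elim=> [|d IH] c C c0 C0 cov.
  rewrite expr0 mulr1.
  have /cov : forall i : nat, p <= (fun=> p) i <= q by move=> i; rewrite lexx pq.
  move=> /le_trans; apply.
  by under eq_eseriesr do rewrite big_ord0; under [leRHS]eq_eseriesr do rewrite big_ord0.
have prod0 k x : 0 <= \prod_(i < d) \1_`[l k i, u k i]%classic (x i) :> R.
  by apply: prodr_ge0 => i _; rewrite indicE ler0n.
have ulge0 k i : 0 <= u k i - l k i by rewrite subr_ge0.
under eq_eseriesr do rewrite big_ord_recr /= [X in _ * X]mulrC mulrA.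
rewrite exprS mulrA.
apply: (IH (fun k => c k * (u k d - l k d))).
- by move=> k; rewrite mulr_ge0.
- by rewrite mulr_ge0 // subr_ge0.
move=> x px.
pose g k (t : R) : \bar R :=
  ((c k * \prod_(i < d) \1_`[l k i, u k i]%classic (x i)) *
    \1_`[l k d, u k d]%classic t)%:E.
have g0 k t : (0 <= g k t)%E.
  by rewrite lee_fin !mulr_ge0 // indicE ler0n.
have mg k : measurable_fun `[p, q]%classic (g k).
  by apply/measurable_EFinP; apply: measurable_funM.
have Cg t : `[p, q]%classic t -> (C%:E <= \sum_(k <oo) g k t)%E.
  rewrite /= in_itv /= => pt.
  pose y i := if i == d then t else x i.
  have /cov : forall i, p <= y i <= q by move=> i; rewrite /y; case: eqP.
  move=> /le_trans; apply; apply: lee_nneseries => [k _ _|k _].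
    by rewrite lee_fin mulr_ge0 //; apply: prodr_ge0 => i _; rewrite indicE ler0n.
  rewrite big_ord_recr /= mulrA /g {2}/y eqxx.
  rewrite (eq_bigr (fun i : 'I_d => \1_`[l k i, u k i]%classic (x i))) // => i _.
  by rewrite /y ltn_eqF.
(* Integrate the covering inequality over the last coordinate. *)
have -> : (C * (q - p))%:E =
    (\int[lebesgue_measure]_(t in `[p, q]%classic) (cst C%:E t))%E.
  rewrite integral_cst //= lebesgue_measure_itv /= lte_fin.
  by case: ltgtP pq => // -> _; rewrite subrr mulr0 mule0.
apply: (@le_trans _ _
    (\int[lebesgue_measure]_(t in `[p, q]%classic) \sum_(k <oo) g k t)%E).
  apply: ge0_le_integral => //.
  exact: (@ge0_emeasurable_sum _ _ R `[p, q]%classic g xpredT).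
rewrite integral_nneseries //.
apply: lee_nneseries => [k _ _|k _]; first exact: integral_ge0.
rewrite /g; under eq_integral do rewrite EFinM.
rewrite ge0_integralZl_EFin ?mulr_ge0 //; last first.
  by apply/measurable_EFinP; exact: measurable_indic.
rewrite integral_indic // mulrAC [leRHS]EFinM.
apply: lee_wpmul2l; first by rewrite lee_fin mulr_ge0.
apply: (@le_trans _ _ (lebesgue_measure `[l k d, u k d]%classic)).
  by apply: le_measure; rewrite ?inE; [exact: measurableI| |exact: subIsetl].
rewrite lebesgue_measure_itv /= lte_fin.
by case: ltgtP (lu k d) => // -> _; rewrite subrr.
Qed.

Definition cube (R : realType) (d : nat) (p q : R) : set 'rV[R]_d :=
  [set x | forall i, p <= x ord0 i <= q].
Arguments cube {R} d p q.

Lemma lebesgue_outer_measure_cube_ge (R : realType) (d : nat) (p q : R) :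
  p <= q ->
  (((q - p) ^+ d.+1)%:E <=
    lebesgue_outer_measure (cube d.+1 p q))%E.
Proof.
move=> pq; apply: le_ereal_inf_tmp => _ [ab [le_ab cov] <-].
pose l k i := (ab k).1 ord0 (inord i : 'I_d.+1).
pose u k i := (ab k).2 ord0 (inord i : 'I_d.+1).
have := @le_coef_sum_prod_indic R p q l u pq (fun k i => le_ab k (inord i))
  d.+1 (fun=> 1) 1 (fun=> ler01) ler01.
rewrite mul1r => H; apply: le_trans; first apply: H.
  move=> x px.
  have [|k _ xk] := cov (\row_(i < d.+1) x i); first by move=> i; rewrite mxE.
  have pos j : (0 <= (1 * \prod_(i < d.+1) \1_`[l j i, u j i]%classic (x i))%:E :> \bar R)%E.
    by rewrite lee_fin mul1r; apply: prodr_ge0 => i _; rewrite indicE ler0n.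
  rewrite nneseries_esumT //; apply: esum_ge.
  exists [set k]; first by split.
  rewrite fsbig_set1 lee_fin mul1r big1 // => i _.
  by rewrite indicE mem_set //= in_itv /= /l /u inord_val; move: (xk i); rewrite mxE.
apply: lee_nneseries => [k _ _|k _].
  by rewrite lee_fin mul1r; apply: prodr_ge0 => i _; rewrite subr_ge0 le_ab.
rewrite lee_fin mul1r /box_volume.
rewrite (eq_bigr (fun i => (ab k).2 ord0 i - (ab k).1 ord0 i)) // => i _.
by rewrite /l /u inord_val.
Qed.

(** * Decreasing sequences of measurable sets *)

Definition outer_measure_restr (R : realType) (T : Type) (mu : set T -> \bar R)
  (B : set T) : set T -> \bar R := fun X => mu (X `&` B).

Section outer_measure_restr.
Variables (R : realType) (T : Type).
Variables (mu : {outer_measure set T -> \bar R}) (B : set T).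

Let restr0 : outer_measure_restr mu B set0 = 0%E.
Proof. by rewrite /outer_measure_restr set0I outer_measure0. Qed.

Let restr_ge0 X : (0 <= outer_measure_restr mu B X)%E.
Proof. exact: outer_measure_ge0. Qed.

Let le_restr : {homo outer_measure_restr mu B : X Y / X `<=` Y >-> (X <= Y)%E}.
Proof. by move=> X Y XY; apply: le_outer_measure; exact: setSI. Qed.

Let restr_sigma_subadditive : sigma_subadditive (outer_measure_restr mu B).
Proof.
move=> F; rewrite /outer_measure_restr setI_bigcupl.
exact: outer_measure_sigma_subadditive.
Qed.

HB.instance Definition _ := isOuterMeasure.Build R T
  (outer_measure_restr mu B) restr0 restr_ge0 le_restr restr_sigma_subadditive.

End outer_measure_restr.

Lemma caratheodory_measurable_restr (R : realType) (T : Type)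
    (mu : set T -> \bar R) (A B : set T) :
  mu.-caratheodory A -> (outer_measure_restr mu B).-caratheodory A.
Proof.
move=> mA X; rewrite /outer_measure_restr (mA (X `&` B)).
by rewrite !(setIAC _ B).
Qed.

(** Restricting the outer measure to [B] makes it finite and keeps the sets
    [F n] Caratheodory measurable, so that continuity from above applies to the
    restricted measure. *)
Lemma nonincreasing_cvg0_outer_measure (R : realType) (T : pointedType)
    (mu : {outer_measure set T -> \bar R}) (B : set T) (F : nat -> set T) :
  (mu B < +oo)%E -> (forall n, mu.-caratheodory (F n)) ->
  nonincreasing_seq F -> \bigcap_n F n = set0 ->
  (fun n => mu (F n `&` B)) @ \oo --> 0%E.
Proof.
move=> Bfin mF niF F0.
pose nu : {outer_measure set T -> \bar R} := outer_measure_restr mu B.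
have mnu n : measurable (F n : set (caratheodory_type nu)).
  exact: caratheodory_measurable_restr.
have := @nonincreasing_cvg_mu _ (caratheodory_type nu) _
  (nu : set (caratheodory_type nu) -> \bar R) F.
rewrite F0 measure0; apply => //.
by apply: le_lt_trans Bfin; apply: le_outer_measure; exact: subIsetr.
Qed.

Lemma outer_measure_le_sum_fin (R : realType) (T : Type) (I : finType)
    (mu : {outer_measure set T -> \bar R}) (X : set T) (F : I -> set T) :
  X `<=` \bigcup_i F i -> (mu X <= \sum_(i in I) mu (F i))%E.
Proof.
move=> XF; pose G n := oapp F set0 (nth None [seq Some i | i <- enum I] n).
have := outer_measure_subadditive mu G #|I|.
have Gi (k : 'I_#|I|) : G k = F (enum_val k).
  by rewrite /G (nth_map (enum_val k)) -?cardE // -enum_val_nth.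
rewrite [in X in _ -> X]big_enum_val /=.
under [X in (_ <= X)%E -> _]eq_bigr do rewrite Gi.
apply: le_trans; apply: le_outer_measure => x /XF[i _ Fx].
rewrite -(bigcup_mkord _ G); exists (enum_rank i) => /=; first exact: ltn_ord.
by rewrite Gi enum_rankK.
Qed.

(** * Splitting coordinates of a subadditive function *)

Definition reflect_coords (R : realType) (d : nat) (x : 'rV[R]_d)
    (A : {set 'I_d}) (y : 'rV[R]_d) : 'rV[R]_d :=
  \row_i (if i \in A then y ord0 i else x ord0 i - y ord0 i).

Lemma set_coordE (R : realType) (d : nat) (x : 'rV[R]_d) (i j : 'I_d) (s : R) :
  set_coord x i s ord0 j = if j == i then s else x ord0 j.
Proof. by rewrite mxE. Qed.

Lemma le_split_coord (R : realType) (d : nat) (f : 'rV[R]_d -> R)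
    (x : 'rV[R]_d) (i : 'I_d) (s : R) :
  componentwise_subadditive f -> pos_orthant R d x -> 0 < s < x ord0 i ->
  f x <= f (set_coord x i s) + f (set_coord x i (x ord0 i - s)).
Proof.
move=> f_sub x_pos /andP[s0 sx].
have := f_sub i x (fun j _ => x_pos j) s (x ord0 i - s) s0.
rewrite /pos_reals /= subr_gt0 => /(_ sx); rewrite addrC subrK.
suff -> : set_coord x i (x ord0 i) = x by [].
by apply/rowP => j; rewrite set_coordE; case: eqP => [->|].
Qed.

(** Splitting one coordinate bounds [f x] by a sum of two values of [f], the
    larger of which is at least [f x / 2]. Doing this for every
    coordinate in turn, and keeping the larger term each time, loses a factor
    [2 ^ d]. *)
Lemma exists_reflection_ge (R : realType) (d : nat) (f : 'rV[R]_d -> R)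
    (x y : 'rV[R]_d) :
  componentwise_subadditive f -> (forall i, 0 < y ord0 i < x ord0 i) ->
  exists A, f x <= 2 ^+ d * f (reflect_coords x A y).
Proof.
move=> f_sub yx.
have x_pos : pos_orthant R d x.
  by move=> i; have /andP[y0 /(lt_trans y0)] := yx i.
suff [z [zyx fxz]] : exists z : 'rV[R]_d,
    (forall i, z ord0 i = y ord0 i \/ z ord0 i = x ord0 i - y ord0 i) /\
    f x <= 2 ^+ d * f z.
  exists [set i | z ord0 i == y ord0 i]%SET.
  suff -> : reflect_coords x [set i | z ord0 i == y ord0 i]%SET y = z by [].
  apply/rowP => i; rewrite mxE inE.
  by case: (zyx i) => [->|zi]; [rewrite eqxx|case: eqP => // ->].
(* The coordinates below [k] have been split, the others are still those of
   [x]. *)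
suff H k : (k <= d)%N -> exists z : 'rV[R]_d,
    [/\ forall i : 'I_d, (i < k)%N ->
          z ord0 i = y ord0 i \/ z ord0 i = x ord0 i - y ord0 i,
        forall i : 'I_d, (k <= i)%N -> z ord0 i = x ord0 i &
        f x <= 2 ^+ k * f z].
  have [z [zyx _ fxz]] := H d (leqnn d).
  by exists z; split=> // i; exact: zyx.
elim: k => [_|k IH kd]; first by exists x; split => //; rewrite expr0 mul1r.
have [z [zlt zge fxz]] := IH (ltnW kd).
pose i0 := Ordinal kd.
have zi0 : z ord0 i0 = x ord0 i0 by exact: zge.
have z_pos : pos_orthant R d z.
  move=> i; rewrite /pos_reals /=; have [ik|/zge ->] := ltnP i k; last exact: x_pos.
  have /andP[y0 yxi] := yx i.
  by have [->|->] := zlt _ ik; rewrite ?subr_gt0.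
suff [s sE fs] : exists2 s, s = y ord0 i0 \/ s = x ord0 i0 - y ord0 i0 &
    f z <= 2 * f (set_coord z i0 s).
  exists (set_coord z i0 s); split.
  - move=> i; rewrite ltnS leq_eqVlt set_coordE => /orP[/eqP ik|ik].
      by rewrite (_ : i = i0) ?eqxx //; exact/val_inj.
    by rewrite ifN; [exact: zlt|rewrite -val_eqE /= ltn_eqF].
  - move=> i ki; rewrite set_coordE ifN; first exact/zge/ltnW.
    by rewrite -val_eqE /= gtn_eqF.
  - by apply: (le_trans fxz); rewrite exprSr -mulrA ler_pM2l // exprn_gt0.
have yz : 0 < y ord0 i0 < z ord0 i0 by rewrite zi0.
have := le_split_coord f_sub z_pos yz; rewrite zi0.
set u := f (set_coord z i0 (y _ _)); set v := f (set_coord z i0 (_ - _)) => fuv.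
have [uv|vu] := lerP u v.
- by exists (x ord0 i0 - y ord0 i0); [right|rewrite -/v; lra].
- by exists (y ord0 i0); [left|rewrite -/u; lra].
Qed.

(** The constant point [c] is moved to [x] one coordinate at a time; each step
    splits [c] as [x_i + (c - x_i)] and costs at most [M]. *)
Lemma le_swap_coords (R : realType) (d : nat) (f : 'rV[R]_d -> R)
    (x : 'rV[R]_d) (c M : R) :
  componentwise_subadditive f -> (forall i, 0 < x ord0 i < c) ->
  (forall z : 'rV[R]_d, (forall i, [\/ z ord0 i = x ord0 i, z ord0 i = c |
      z ord0 i = c - x ord0 i]) -> f z <= M) ->
  f (const_mx c) <= f x + d%:R * M.
Proof.
move=> f_sub xc fM.
pose z k : 'rV[R]_d := \row_i (if (i < k)%N then x ord0 i else c).
suff H k : (k <= d)%N -> f (const_mx c) <= f (z k) + k%:R * M.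
  have := H d (leqnn d); suff -> : z d = x by [].
  by apply/rowP => i; rewrite mxE ltn_ord.
elim: k => [_|k IH kd].
  rewrite mul0r addr0; suff -> : z 0%N = const_mx c by [].
  by apply/rowP => i; rewrite !mxE.
apply: (le_trans (IH (ltnW kd))).
pose i0 := Ordinal kd.
have z_pos : pos_orthant R d (z k).
  move=> i; rewrite /pos_reals /= mxE; have /andP[x0 /(lt_trans x0) c0] := xc i.
  by case: ifP.
have zi0 : z k ord0 i0 = c by rewrite mxE ltnn.
have xz : 0 < x ord0 i0 < z k ord0 i0 by rewrite zi0.
have := le_split_coord f_sub z_pos xz; rewrite zi0.
have -> : set_coord (z k) i0 (x ord0 i0) = z k.+1.
  apply/rowP => i; rewrite set_coordE !mxE ltnS [in RHS]leq_eqVlt -val_eqE /=.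
  by case: eqP => // ik; congr (x ord0 _); exact/val_inj.
have : f (set_coord (z k) i0 (c - x ord0 i0)) <= M.
  apply: fM => i; rewrite set_coordE mxE.
  case: eqP => [->|_]; first exact: Or33.
  by case: ifP => _; [exact: Or31|exact: Or32].
rewrite -natr1 mulrDl mul1r; lra.
Qed.

(** * Boundedness *)

(** A reflection in some of the coordinates exchanges the endpoints of the
    corresponding sides of a box, so it carries covers to covers and keeps the
    volumes. *)
Lemma lebesgue_outer_measure_reflect_le (R : realType) (d : nat)
    (x : 'rV[R]_d) (A : {set 'I_d}) (X : set 'rV[R]_d) :
  (lebesgue_outer_measure (reflect_coords x A @^-1` X) <=
    lebesgue_outer_measure X)%E.
Proof.
apply: le_ereal_inf_tmp => _ [ab [le_ab cov] <-].
pose cd k : 'rV[R]_d * 'rV[R]_d :=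
  (\row_i (if i \in A then (ab k).1 ord0 i else x ord0 i - (ab k).2 ord0 i),
   \row_i (if i \in A then (ab k).2 ord0 i else x ord0 i - (ab k).1 ord0 i)).
apply: ge_ereal_inf; exists (\sum_(k <oo) (box_volume (ab k))%:E)%E => //.
exists cd; first split.
- move=> k i; rewrite !mxE; case: ifP => _; first exact: le_ab.
  by rewrite lerB.
- move=> y /cov[k _ yk]; exists k => // i; have := yk i; rewrite !mxE.
  by case: ifP => // _ /andP[? ?]; apply/andP; split; lra.
apply: eq_eseriesr => k _; congr EFin; apply: eq_bigr => i _.
by rewrite !mxE; case: ifP => // _; lra.
Qed.

(** A value above [2 ^ d.+1 * n] at one point of the cube forces [f >= n] on a set
    whose measure is bounded below independently of the point and of [n]. *)
Lemma bounded_above_on_cube (R : realType) (d : nat) (f : 'rV[R]_d.+1 -> R)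
    (a b : R) :
  lebesgue_measurable_fun (pos_orthant R d.+1) f ->
  componentwise_subadditive f -> 0 < a ->
  exists M, forall x, cube d.+1 a b x -> f x <= M.
Proof.
move=> f_meas f_sub a0.
pose mu : {outer_measure set 'rV[R]_d.+1 -> \bar R} :=
  @lebesgue_outer_measure R d.+1.
have [ba|ab] := ltP b a.
  exists 0 => x /(_ ord0) /andP[ax xb].
  by have := lt_le_trans ba (le_trans ax xb); rewrite ltxx.
pose P := pos_orthant R d.+1.
pose E (n : nat) := P `&` f @^-1` `[n%:R, +oo[%classic.
pose B := cube d.+1 0 b.
have muB : (mu B < +oo)%E.
  apply: le_lt_trans (ltry (box_volume (const_mx 0, const_mx b : 'rV[R]_d.+1))).
  apply: lebesgue_outer_measure_box_le => /= [i|y yB i]; rewrite !mxE //.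
  exact: le_trans (ltW a0) ab.
have mE n : mu.-caratheodory (E n).
  exact: f_meas (measurable_itv _).
have niE : nonincreasing_seq E.
  move=> m n mn; apply/subsetPset => y [Py]; rewrite /= !in_itv /= !andbT => fy.
  by split=> //=; rewrite in_itv /= andbT; apply: le_trans fy; rewrite ler_nat.
have E0 : \bigcap_n E n = set0.
  rewrite -subset0 => y Ey.
  have [_] := Ey (Num.truncn `|f y|).+1 I; rewrite /= in_itv /= andbT.
  by apply/negP; rewrite -ltNge (le_lt_trans (ler_norm _)) // truncnS_gt.
(* Any cube strictly between [0] and [a] in every coordinate would do: it
   lies below each [x] of [[a, b]^d]. *)
pose p := a / 3; pose q := 2 * a / 3.
have pq : p < q by rewrite /p /q; lra.
pose N := #|{set 'I_d.+1}|.
have N0 : (0 < N)%N by apply/card_gt0P; exists finset.set0.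
have e0 : 0 < (q - p) ^+ d.+1 / N%:R.
  by rewrite divr_gt0 ?ltr0n // exprn_gt0 // subr_gt0.
have [n muEn] : exists n, (mu (E n `&` B) < ((q - p) ^+ d.+1 / N%:R)%:E)%E.
  have /= cE := nonincreasing_cvg0_outer_measure muB mE niE E0.
  have [] := cE _ (@open_ereal_lt' _ 0%E ((q - p) ^+ d.+1 / N%:R)%:E e0).
  by move=> n _ /(_ n (leqnn n)) ?; exists n.
exists (2 ^+ d.+1 * n%:R) => x xab; rewrite leNgt; apply/negP => fx.
have cov : cube d.+1 p q `<=`
    \bigcup_(A : {set 'I_d.+1}) reflect_coords x A @^-1` (E n `&` B).
  move=> y yC.
  have yx i : 0 < y ord0 i < x ord0 i.
    have /andP[py yq] := yC i; have /andP[ax xb] := xab i.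
    by rewrite /p /q in py yq; apply/andP; split; lra.
  have [A fA] := exists_reflection_ge f_sub yx; exists A => //.
  have zx i : 0 < reflect_coords x A y ord0 i < x ord0 i.
    by rewrite mxE; have /andP[] := yx i; case: ifP => _ ? ?; apply/andP; split; lra.
  split; first split.
  - by move=> i; have /andP[] := zx i.
  - rewrite /= in_itv /= andbT.
    have := lt_le_trans fx fA; rewrite ltr_pM2l ?exprn_gt0 //; exact: ltW.
  - move=> i; have /andP[z0 /ltW zxi] := zx i; have /andP[_ xb] := xab i.
    by rewrite (ltW z0) (le_trans zxi).
have := lebesgue_outer_measure_cube_ge d (ltW pq).
apply/negP; rewrite -ltNge.
apply: (le_lt_trans (outer_measure_le_sum_fin mu cov)).
apply: (@le_lt_trans _ _ (\sum_(A in {set 'I_d.+1}) mu (E n `&` B))%E).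
  by apply: lee_sum => A _; exact: lebesgue_outer_measure_reflect_le.
have /fineK <- : mu (E n `&` B) \is a fin_num.
  by rewrite ge0_fin_numE ?outer_measure_ge0 // (lt_trans muEn) // ltry.
rewrite sumEFin sumr_const lte_fin -mulr_natr -ltr_pdivlMr ?ltr0n //.
by rewrite -lte_fin fineK // ge0_fin_numE ?outer_measure_ge0 // (lt_trans muEn) // ltry.
Qed.

Lemma compact_subset_cube (R : realType) (d : nat) (K : set 'rV[R]_d) :
  compact K -> K `<=` pos_orthant R d ->
  exists a b, 0 < a /\ K `<=` cube d a b.
Proof.
move=> cK sK; have [->|/set0P K0] := eqVneq K set0; first by exists 1, 1; split.
have ex (i : 'I_d) : exists ab : R * R, 0 < ab.1 /\
    forall x, K x -> ab.1 <= x ord0 i <= ab.2.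
  have ci : {within K, continuous (fun x : 'rV[R]_d => x ord0 i)}.
    exact/continuous_subspaceT/coord_continuous.
  have [u uK umin] := EVT_min_rV K0 cK ci.
  have [v vK vmax] := EVT_max_rV K0 cK ci.
  exists (u ord0 i, v ord0 i); split; first by apply: sK; rewrite inE in uK.
  by move=> x Kx /=; rewrite umin ?inE // vmax ?inE.
have [ab abP] := choice ex.
exists (\big[Num.min/1]_i (ab i).1), (\big[Num.max/0]_i (ab i).2); split.
  by apply/bigmin_gtP; split=> // i _; exact: (abP i).1.
move=> x Kx i; have /andP[ax xb] := (abP i).2 x Kx.
rewrite (le_trans _ ax) /=; last exact: bigmin_le.
by rewrite (le_trans xb) //; exact: (le_bigmax _ (fun i => (ab i).2)).
Qed.

Theorem theorem4p5 (R : realType) (d : nat) (hd : (1 <= d)%N)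
    (f : 'rV[R]_d -> R)
    (f_meas : lebesgue_measurable_fun (pos_orthant R d) f)
    (f_subadd : componentwise_subadditive f)
    (K : set 'rV[R]_d) (K_compact : compact K) (K_sub : K `<=` pos_orthant R d) :
  has_ubound (f @` K) /\ has_lbound (f @` K).
Proof.
have [a [b [a0 Kab]]] := compact_subset_cube K_compact K_sub.
case: d hd f f_meas f_subadd K K_compact K_sub Kab => // d _ f f_meas f_sub K _ _ Kab.
split.
  have [M fM] := bounded_above_on_cube b f_meas f_sub a0.
  by exists M => _ [x /Kab xab <-]; exact: fM.
(* With [c = b + 1], the numbers [x_i], [c] and [c - x_i >= 1] all lie between
   [min a 1] and [b + 1]. *)
have a1 : 0 < Num.min a 1 by rewrite lt_min a0 ltr01.
have [M fM] := bounded_above_on_cube (b + 1) f_meas f_sub a1.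
exists (f (const_mx (b + 1)) - d.+1%:R * M) => _ [x /Kab xab <-].
rewrite lerBlDr; apply: le_swap_coords => // [i|z zx].
  by have /andP[ax xb] := xab i; apply/andP; split; lra.
apply: fM => i; have /andP[ax xb] := xab i.
rewrite ge_min.
by case: (zx i) => ->; apply/andP; split; try (apply/orP; (left; lra) || (right; lra)); lra.
Qed.
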